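(* Let $I\subset[0,\infty)$ be an interval and let $f:I\to\mathbb{R}$ be a differentiable function on $I^{\circ}$, the interior of $I$, such that $f'\in L[a,b]$, where $a,b\in I$ with $a<b$. Let $q\ge1$ and $\alpha>0$. If $|f'|^{q}$ is $s$-convex on $[a,b]$ for some fixed $s\in(0,1]$ and $x\in[a,b]$, then $$\left|\frac{(x-a)^{\alpha}f(a)+(b-x)^{\alpha}f(b)}{b-a}-\frac{\Gamma(\alpha+1)}{b-a}\left[J_{x^{-}}^{\alpha}f(a)+J_{x^{+}}^{\alpha}f(b)\right]\right|$$ $$\le\left(\frac{\alpha}{\alpha+1}\right)^{1-\frac1q}\Bigg\{\frac{(x-a)^{\alpha+1}}{b-a}\left(\frac{\alpha}{(s+1)(\alpha+s+1)}|f'(x)|^{q}+\left[\frac{1}{s+1}-\frac{\Gamma(\alpha+1)\Gamma(s+1)}{\Gamma(\alpha+s+2)}\right]|f'(a)|^{q}\right)^{\frac1q}$$ $$+\frac{(b-x)^{\alpha+1}}{b-a}\left(\frac{\alpha}{(s+1)(\alpha+s+1)}|f'(x)|^{q}+\left[\frac{1}{s+1}-\frac{\Gamma(\alpha+1)\Gamma(s+1)}{\Gamma(\alpha+s+2)}\right]|f'(b)|^{q}\right)^{\frac1q}\Bigg\}.$$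
   Context: $\Gamma(\alpha)=\int_0^\infty e^{-u}u^{\alpha-1}\,du$ is the Euler Gamma function. The Riemann-Liouville fractional integrals of order $\alpha>0$ are $J_{c^{+}}^{\alpha}f(y)=\frac{1}{\Gamma(\alpha)}\int_{c}^{y}(y-t)^{\alpha-1}f(t)\,dt$ for $y>c$ and $J_{d^{-}}^{\alpha}f(y)=\frac{1}{\Gamma(\alpha)}\int_{y}^{d}(t-y)^{\alpha-1}f(t)\,dt$ for $y<d$. Thus $$J_{x^{-}}^{\alpha}f(a)=\frac{1}{\Gamma(\alpha)}\int_{a}^{x}(t-a)^{\alpha-1}f(t)\,dt,\qquad J_{x^{+}}^{\alpha}f(b)=\frac{1}{\Gamma(\alpha)}\int_{x}^{b}(b-t)^{\alpha-1}f(t)\,dt,$$ where the first is $0$ if $x=a$ and the second is $0$ if $x=b$. $f'\in L[a,b]$ means that $f'$ exists on $[a,b]$ (as a one-sided derivative at $a$ or $b$ if that point is an endpoint of $I$) and is Lebesgue integrable on $[a,b]$. A function $g:[a,b]\to\mathbb{R}$, with $[a,b]\subset[0,\infty)$, is $s$-convex (in the second sense) on $[a,b]$ if $g(\lambda u+\mu v)\le\lambda^{s}g(u)+\mu^{s}g(v)$ for all $u,v\in[a,b]$ and all $\lambda,\mu\ge0$ with $\lambda+\mu=1$. *)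

(* Defs.v *)
From HB Require Import structures.
From mathcomp Require Import all_boot all_order all_algebra.
From mathcomp Require Import all_classical all_reals all_analysis.
Set Implicit Arguments.
Unset Strict Implicit.
Unset Printing Implicit Defensive.
Import Order.TTheory GRing.Theory Num.Theory.
Import numFieldNormedType.Exports.
Local Open Scope classical_set_scope.
Local Open Scope ring_scope.

Definition Gamma {R : realType} (alpha : R) : R :=
  \int[lebesgue_measure]_(u in `]0%R, +oo[) (expR (- u) * u `^ (alpha - 1)).

(* Riemann-Liouville integrals J_{c+}^alpha f(y), for c <= y, and
   J_{d-}^alpha f(y), for y <= d.  The integral over a one-point interval is 0.
   At the singular point t = y, powR returns a real number (0 `^ p = 0 for
   p != 0), which has no effect on the integral. *)
Definition RLplus {R : realType} (c alpha : R) (f : R -> R) (y : R) : R :=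
  (Gamma alpha)^-1 *
  \int[lebesgue_measure]_(t in `[c, y]) ((y - t) `^ (alpha - 1) * f t).

Definition RLminus {R : realType} (d alpha : R) (f : R -> R) (y : R) : R :=
  (Gamma alpha)^-1 *
  \int[lebesgue_measure]_(t in `[y, d]) ((t - y) `^ (alpha - 1) * f t).

(* Derivative at x of f considered as a function on D: the increments h are
   restricted to those with h + x in D.  For D a nondegenerate interval and
   x in D, this is the two-sided derivative if x is interior to D and the
   one-sided derivative if x is an endpoint of D. *)
Definition derivable_in {R : realType} (D : set R) (f : R -> R) (x : R) : Prop :=
  cvg ((fun h : R => h^-1 *: (f (h + x) - f x)) @
         within [set h | D (h + x)] 0^').

Definition derive_in {R : realType} (D : set R) (f : R -> R) (x : R) : R :=
  lim ((fun h : R => h^-1 *: (f (h + x) - f x)) @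
         within [set h | D (h + x)] 0^').

Definition s_convex_on {R : realType} (s : R) (D : set R) (g : R -> R) : Prop :=
  forall u v : R, D u -> D v ->
  forall lambda mu : R, 0 <= lambda -> 0 <= mu -> lambda + mu = 1 ->
    g (lambda * u + mu * v) <= lambda `^ s * g u + mu `^ s * g v.

Lemma within_shift_interior {R : realType} (D : set R) (x : R) :
  D° x -> within [set h | D (h + x)] (0 : R)^' = (0 : R)^'.
Proof.
move=> Dx.
have D0 : (0 : R)^' [set h | D (h + x)].
  apply: (@nbhs_dnbhs R 0 [set h | D (h + x)]).
  have : (h + x) @[h --> (0 : R)] --> x.
    rewrite -[X in _ --> X]add0r.
    by apply: cvgD; [exact: cvg_id | exact: cvg_cst].
  by move/(_ _ Dx).
apply/seteqP; split => A.
  by rewrite /within/= => wA; apply: filterS2 D0 wA => h Dh; apply.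
by rewrite /within/=; apply: filterS => h Ah _.
Qed.

Lemma derive_in_interior {R : realType} (D : set R) (f : R -> R) (x : R) :
  D° x -> derive_in D f x = derive1 f x.
Proof. by move=> Dx; rewrite /derive_in within_shift_interior. Qed.

(* Main.v *)
Require Import Defs.
From HB Require Import structures.
From mathcomp Require Import all_boot all_order all_algebra.
From mathcomp Require Import all_classical all_reals all_analysis.
From mathcomp Require Import measurable_realfun ring lra.
Import Order.TTheory GRing.Theory Num.Theory.
Import numFieldNormedType.Exports.
Local Open Scope classical_set_scope.
Local Open Scope ring_scope.

(** Let [p] be the order of the fractional integrals.  Write [L = x - e] for an
    endpoint [e] of [[a, b]], and [t = (u - e) / L] for the position of [u] between
    [e] (where [t = 0]) and [x] (where [t = 1]); [L] is negative when [e = b], and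
    this sign makes both sides of [x] obey the same formulas.  Up to the factor
    [b - a], the left-hand side is the sum over the two endpoints of
    [|L| ^ p * f e - p * \int |u - e| ^ (p - 1) * f u
      = p * \int |u - e| ^ (p - 1) * (f e - f u)],
    where the integrals run between [e] and [x], because
    [\int p * |u - e| ^ (p - 1) = |L| ^ p].  It is therefore enough to bound the
    increments [|f u - f e|], which the mean value theorem does.

    The [s]-convexity of [|f'| ^ q] gives [|f' u| ^ q <= phi t] with
    [phi t = A * t ^ s + B * (1 - t) ^ s], [A = |f' x| ^ q], [B = |f' e| ^ q].
    The concave function [y ^ (1 / q)] lies below each of its tangents
    ([exists_linear_majorant]), so [|f' u| <= c0 + c1 * phi t].  The right-hand
    side has an explicit primitive [majorant], and the mean value theorem turns
    the bound on [f'] into [|f u - f e| <= |L| * majorant t]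
    ([increment_le_majorant]).  Integrating this against the singular kernel
    ([one_sided_bound]) gives [|L| ^ (p + 1) * (c0 * K + c1 * S)], where [K] and
    [S] are the integrals of [1 - t ^ p] and of [(1 - t ^ p) * phi t] over
    [[0, 1]].  The tangent at [y = S / K] makes [c0 * K + c1 * S] equal to
    [K ^ (1 - 1 / q) * S ^ (1 / q)], which is what the power-mean inequality
    would give ([side_estimate]).

    The coefficient of [B] in [S] contains the Beta integral of
    [t ^ p * (1 - t) ^ s].  It is evaluated by the convolution argument: Tonelli
    on the triangle [0 < u <= w] applied to [e ^ (- w) * u ^ p * (w - u) ^ s]
    ([Gamma_beta]).  Tonelli on the same triangle also gives the recurrence
    [Gamma (p + 1) = p * Gamma p] ([GammaD1]). *)

Set Implicit Arguments.
Unset Strict Implicit.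

(** * Real powers *)

Lemma continuous_at_powR {R : realType} (r t : R) :
  0 < t -> {for t, continuous (fun u : R => u `^ r)}.
Proof.
move=> t0; apply/differentiable_continuous/derivable1_diffP/derivable_powR.
by rewrite in_itv/= t0.
Qed.

(** The absolute value makes the power continuous on the whole line: [powR] takes
    the value 1 at negative bases, so [t `^ r] itself jumps at 0.  Writing powers
    this way avoids continuity relative to subsets at the ends of [[0, 1]]. *)
Lemma continuous_normr_powR {R : realType} (r : R) :
  0 < r -> continuous (fun t : R => `|t| `^ r).
Proof.
move=> r0 t; have [->|t0] := eqVneq t 0.
  rewrite /continuous_at normr0 powR0 ?gt_eqF//.
  apply/cvgrPdist_le => /= e e0.
  near=> u.
  rewrite sub0r normrN ger0_norm ?powR_ge0//.
  (* Makes the modulus of continuity at 0 visible. *)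
  have -> : e = (e `^ r^-1) `^ r.
    by rewrite -powRrM mulVf ?gt_eqF// powRr1// ltW.
  apply: ge0_ler_powR; rewrite ?nnegrE ?powR_ge0 ?(ltW r0)//.
  by near: u; apply: (@nbhs0_le _ R^o); exact: powR_gt0.
have cn : {for t, continuous (fun u : R => `|u|)} by exact: norm_continuous.
suff cp : {for `|t|, continuous (fun y : R => y `^ r)} by exact: (continuous_comp cn cp).
by apply: continuous_at_powR; rewrite normr_gt0.
Unshelve. all: by end_near. Qed.

Lemma is_derive_normr_powR {R : realType} (r t : R) :
  0 < t -> is_derive t 1 (fun t : R => `|t| `^ r) (r * t `^ (r - 1)).
Proof.
move=> t0; apply: (@near_eq_is_derive _ _ _ (fun y : R => y `^ r)).
  near=> u; rewrite ger0_norm//; apply: ltW.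
  by near: u; exact: lt_nbhsr.
exact: is_derive1_powR.
Unshelve. all: by end_near. Qed.

Lemma continuous_normr_onem_powR {R : realType} (r : R) : 0 < r ->
  continuous (fun t : R => `|1 - t| `^ r).
Proof.
move=> r0 v.
apply: (@continuous_comp _ _ _ (fun v : R => 1 - v) (fun t => `|t| `^ r) v).
  by apply: cvgB; [exact: cvg_cst|exact: cvg_id].
exact: continuous_normr_powR.
Qed.

Lemma is_derive_normr_onem_powR {R : realType} (r t : R) : t < 1 ->
  is_derive t 1 (fun t : R => `|1 - t| `^ r) (- (r * (1 - t) `^ (r - 1))).
Proof.
move=> t1; have t1' : 0 < 1 - t by rewrite subr_gt0.
have d1 := is_derive_normr_powR r t1'.
have d2 : is_derive t 1 (fun u : R => 1 - u) (-1).
  rewrite (_ : (fun u : R => 1 - u) = cst 1 - id)//.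
  by apply: is_derive_eq; rewrite sub0r.
have d3 := @is_derive1_comp _ (fun t => `|t| `^ r) (fun u => 1 - u) t _ _ d1 d2.
by apply: is_derive_eq; rewrite mulrN1.
Qed.

Lemma powR_onem_le {R : realType} (s t : R) : 0 < s -> 0 <= t <= 1 ->
  (1 - t) `^ (s + 1) <= 1 - t.
Proof.
move=> s0 /andP[t0]; rewrite le_eqVlt => /predU1P[->|t1].
  by rewrite subrr powR0// gt_eqF//; lra.
by apply: ge1r_powR; lra.
Qed.

(** The right-hand side is the tangent of [y `^ p] at [y0].  With
    [y = y0 * expR L] the inequality follows by combining two instances of
    [1 + w <= expR w], at [w = L - L * p] with weight [p] and at [w = - (L * p)]
    with weight [1 - p]: the linear parts add up to 1. *)
Lemma powR_le_tangent {R : realType} (p y y0 : R) :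
  0 < p -> p <= 1 -> 0 < y0 -> 0 <= y ->
  y `^ p <= (1 - p) * y0 `^ p + p * y0 `^ (p - 1) * y.
Proof.
move=> p0 p1 y00; rewrite le_eqVlt => /predU1P[<-|y_gt0].
  by rewrite powR0 ?gt_eqF// mulr0 addr0 mulr_ge0 ?powR_ge0 ?subr_ge0.
set L := ln (y / y0).
have yE : y = y0 * expR L.
  by rewrite lnK ?posrE ?divr_gt0// mulrC divfK// gt_eqF.
have -> : y0 `^ (p - 1) = y0 `^ p / y0.
  by rewrite powRB ?(gt_eqF y00) ?implybT// powRr1// ltW.
have -> : (1 - p) * y0 `^ p + p * (y0 `^ p / y0) * y =
    y0 `^ p * (1 - p + p * expR L).
  by rewrite yE; field; rewrite gt_eqF.
rewrite {1}yE powRM ?expR_ge0 ?(ltW y00)// ler_wpM2l ?powR_ge0//.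
rewrite -expRM.
have h1 : 1 + (L - L * p) <= expR (L - L * p) by exact: expR_ge1Dx.
have h2 : 1 + (- (L * p)) <= expR (- (L * p)) by exact: expR_ge1Dx.
have h : 1 <= (1 - p) * expR (- (L * p)) + p * expR (L - L * p).
  have : (1 - p) * (1 + (- (L * p))) + p * (1 + (L - L * p)) <=
         (1 - p) * expR (- (L * p)) + p * expR (L - L * p).
    by rewrite lerD// ler_wpM2l ?subr_ge0// ltW.
  by apply: le_trans; rewrite le_eqVlt; apply/orP; left; apply/eqP; ring.
have : expR (L * p) * 1 <=
  expR (L * p) * ((1 - p) * expR (- (L * p)) + p * expR (L - L * p)).
  by rewrite ler_wpM2l ?expR_ge0.
rewrite mulr1 => /le_trans; apply.
rewrite expRB expRN le_eqVlt; apply/orP; left; apply/eqP; field.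
by rewrite gt_eqF ?expR_gt0.
Qed.

(** The power-mean inequality in pointwise form.  If [K] is the mass of a measure
    and [S] the integral of [y], integrating the linear bound yields
    [K `^ (1 - r) * S `^ r]; the optimal tangent is the one at the mean
    [S / K]. *)
Lemma exists_linear_majorant {R : realType} (r K S : R) :
  0 < r -> r <= 1 -> 0 < K -> 0 < S ->
  exists c0 c1 : R, [/\ 0 <= c0, 0 <= c1,
    forall y, 0 <= y -> y `^ r <= c0 + c1 * y &
    c0 * K + c1 * S = K `^ (1 - r) * S `^ r].
Proof.
move=> r0 r1 K0 S0; have y0 : 0 < S / K by rewrite divr_gt0.
exists ((1 - r) * (S / K) `^ r), (r * (S / K) `^ (r - 1)); split.
- by rewrite mulr_ge0 ?powR_ge0// subr_ge0.
- by rewrite mulr_ge0 ?powR_ge0// ltW.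
- by move=> y y_ge0; exact: powR_le_tangent.
- have -> : (S / K) `^ (r - 1) = (S / K) `^ r / (S / K).
    by rewrite powRB ?(gt_eqF y0) ?implybT// powRr1// ltW.
  have -> : K `^ (1 - r) = K / K `^ r.
    by rewrite powRB ?(gt_eqF K0) ?implybT// powRr1// ltW.
  have -> : (S / K) `^ r = S `^ r / K `^ r.
    by rewrite powRM ?invr_ge0 ?ltW// -powR_inv1 ?ltW// powRAC powR_inv1 ?powR_ge0.
  by field; rewrite !gt_eqF ?powR_gt0.
Qed.

(** * Primitives of nonnegative functions with endpoint singularities *)

(** The integrand may blow up at both ends, as [u `^ (p - 1)] does for [p < 1];
    nonnegativity replaces integrability, by monotone convergence along an
    increasing sequence of compact subintervals. *)
Lemma ge0_open_continuous_FTC2 {R : realType} (f F : R -> R) (a b : R) :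
  a < b ->
  {in `]a, b[, forall t : R, 0 <= f t} ->
  {in `]a, b[, continuous f} ->
  {in `[a, b], continuous F} ->
  {in `]a, b[, forall t : R, is_derive t 1 F (f t)} ->
  (\int[lebesgue_measure]_(t in `[a, b]) (f t)%:E = (F b - F a)%:E)%E.
Proof.
move=> ab f0 cf cF dF.
rewrite integral_itv_bndoo; last first.
  apply/measurable_EFinP.
  apply: open_continuous_measurable_fun => // t.
  by rewrite inE => /cf.
have mf : measurable_fun `]a, b[%classic (EFin \o f).
  apply/measurable_EFinP.
  apply: open_continuous_measurable_fun => // t.
  by rewrite inE => /cf.
(* [n.+3] keeps [a + d n < b - d n] from [n = 0] on. *)
pose d (n : nat) : R := (b - a) / (n.+3)%:R.
have ba0 : 0 < b - a by rewrite subr_gt0.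
have d0 n : 0 < d n by rewrite divr_gt0.
have dd n : a + d n < b - d n.
  rewrite -subr_gt0; have -> : b - d n - (a + d n) = (b - a) * (1 - 2 / n.+3%:R).
    by rewrite /d; ring.
  by rewrite mulr_gt0// subr_gt0 ltr_pdivrMr// mul1r ltr_nat.
pose E n := `[a + d n, b - d n]%classic.
have Eab n : E n `<=` `]a, b[%classic.
  by move=> t; rewrite /E/= !in_itv/=; move: (d0 n); lra.
have cvgd : d n @[n --> \oo] --> (0 : R).
  rewrite -[X in _ --> X](mulr0 (b - a)); apply: cvgMl_tmp.
  have := @cvg_harmonic R; rewrite -(cvg_shiftn 2) => h.
  by apply: cvg_trans h; apply: near_eq_cvg; apply: nearW => n; rewrite /= addn2.
have EU : \bigcup_n E n = `]a, b[%classic.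
  apply/seteqP; split => [t [n _ /Eab]//|t /=].
  rewrite in_itv/= => /andP[at_ tb].
  have : \forall n \near \oo, d n < Num.min (t - a) (b - t).
    move/cvgrPdist_lt : cvgd => /(_ (Num.min (t - a) (b - t))).
    rewrite lt_min !subr_gt0 at_ tb => /(_ isT).
    by apply: filterS => n; rewrite sub0r normrN gtr0_norm.
  move=> [n _ /(_ n (leqnn n))] /=; rewrite lt_min => /andP[h1 h2].
  by exists n => //; rewrite /E/= in_itv/=; apply/andP; split; lra.
have nE : nondecreasing_seq E.
  move=> m n mn; apply/subsetPset; apply: subset_itvScc => /=; rewrite bnd_simp.
    by rewrite lerD2l ler_pM2l// lef_pV2 ?posrE// ler_nat.
  by rewrite lerD2l lerN2 ler_pM2l// lef_pV2 ?posrE// ler_nat.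
have cvgE : (\int[lebesgue_measure]_(t in E n) (f t)%:E)%E @[n --> \oo] -->
    (\int[lebesgue_measure]_(t in `]a, b[) (f t)%:E)%E.
  rewrite -EU; apply: ge0_nondecreasing_set_cvg_integral => //.
  - by move=> n; exact: measurable_itv.
  - by move=> n; apply: measurable_funS mf.
  - by move=> n t /Eab tab; rewrite lee_fin f0.
have intE n : (\int[lebesgue_measure]_(t in E n) (f t)%:E =
    (F (b - d n) - F (a + d n))%:E)%E.
  rewrite EFinB; apply: continuous_FTC2 => //.
  - apply: continuous_in_subspaceT => t; rewrite inE => /Eab; exact: cf.
  - split.
    + move=> t tE; have : `]a, b[%classic t.
        by apply: (Eab n); apply: subset_itv_oo_cc.
      by move=> /dF [].
    + apply: cvg_at_right_filter; apply: cF.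
      by rewrite in_itv/=; move: (d0 n) (dd n); lra.
    + apply: cvg_at_left_filter; apply: cF.
      by rewrite in_itv/=; move: (d0 n) (dd n); lra.
  - move=> t tE; have : `]a, b[%classic t.
      by apply: (Eab n); apply: subset_itv_oo_cc.
    by move=> /dF [_ <-]; rewrite derive1E.
have cvgF : (F (b - d n) - F (a + d n))%:E @[n --> \oo] --> (F b - F a)%:E.
  apply: cvg_EFin; first exact: nearW.
  apply: cvgB.
  - have cb : {for b, continuous F} by apply: cF; rewrite in_itv/= lexx ltW.
    have cd : b - d n @[n --> \oo] --> b.
      by rewrite -[X in _ --> X]subr0; apply: cvgB => //; exact: cvg_cst.
    exact: (@cvg_comp _ _ _ _ F _ _ _ cd cb).
  - have ca : {for a, continuous F} by apply: cF; rewrite in_itv/= lexx ltW.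
    have cd : a + d n @[n --> \oo] --> a.
      by rewrite -[X in _ --> X]addr0; apply: cvgD => //; exact: cvg_cst.
    exact: (@cvg_comp _ _ _ _ F _ _ _ cd ca).
have -> : (\int[lebesgue_measure]_(t in `]a, b[) (f t)%:E)%E = (F b - F a)%:E.
  apply: (cvg_unique _ cvgE); first exact: ereal_hausdorff.
  by apply: cvg_trans cvgF; apply: near_eq_cvg; apply: nearW => n; rewrite intE.
by rewrite EFinB.
Unshelve. all: by end_near. Qed.

Lemma is_derive_affine {R : realType} (c k t : R) :
  is_derive t 1 (fun u : R => (u - c) / k) k^-1.
Proof.
rewrite (_ : (fun u : R => (u - c) / k) = (k^-1 \*: (id - cst c))); last first.
  by apply/funext => u /=; rewrite mulrC.
by apply: is_derive_eq; rewrite subr0 /GRing.scale/= mulr1.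
Qed.

Lemma continuous_affine {R : realType} (c k : R) :
  continuous (fun u : R => (u - c) / k).
Proof.
move=> t; apply: differentiable_continuous; apply/derivable1_diffP.
by have [] := is_derive_affine c k t.
Qed.

(** [x] may lie on either side of [e]; the affine coordinate is 0 at [e] and 1 at
    [x] in both cases. *)
Lemma affine_oo {R : realType} (e x u : R) : e != x ->
  u \in `]Num.min e x, Num.max e x[ -> (u - e) / (x - e) \in `]0, 1[.
Proof.
move=> ex; rewrite !in_itv/=.
have [lt_ex|lt_xe|/eqP] := ltgtP e x; last by rewrite (negbTE ex).
- have p : 0 < x - e by rewrite subr_gt0.
  by rewrite ltr_pdivlMr// ltr_pdivrMr// mul0r mul1r; lra.
- have p : x - e < 0 by rewrite subr_lt0.
  by rewrite ltr_ndivlMr// ltr_ndivrMr// mul0r mul1r; lra.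
Qed.

Lemma affine_cc {R : realType} (e x u : R) : e != x ->
  u \in `[Num.min e x, Num.max e x] -> (u - e) / (x - e) \in `[0, 1].
Proof.
move=> ex; rewrite !in_itv/=.
have [lt_ex|lt_xe|/eqP] := ltgtP e x; last by rewrite (negbTE ex).
- have p : 0 < x - e by rewrite subr_gt0.
  by rewrite ler_pdivlMr// ler_pdivrMr// mul0r mul1r; lra.
- have p : x - e < 0 by rewrite subr_lt0.
  by rewrite ler_ndivlMr// ler_ndivrMr// mul0r mul1r; lra.
Qed.

(** The factor [x - e] is the signed length, which cancels the inner derivative
    whatever the side of [e] on which [x] lies. *)
Lemma is_derive_comp_affine {R : realType} (F : R -> R) (dF e x u : R) :
  e != x -> is_derive ((u - e) / (x - e)) 1 F dF ->
  is_derive u 1 (fun u => (x - e) * F ((u - e) / (x - e))) dF.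
Proof.
move=> ex d1; have d2 := is_derive_affine e (x - e) u.
have d3 := @is_derive1_comp _ F (fun u => (u - e) / (x - e)) u _ _ d1 d2.
rewrite (_ : (fun u => _) = (x - e) \*: (F \o (fun u : R => (u - e) / (x - e))))//.
apply: is_derive_eq.
by rewrite /GRing.scale/= mulrCA divff ?mulr1// subr_eq0 eq_sym.
Qed.

(** Affine change of variables, stated through primitives so that [q] may be
    singular at 0 and 1. *)
Lemma integral_affine {R : realType} (e x : R) (q Q : R -> R) : e != x ->
  {in `]0, 1[, forall t : R, 0 <= q t} ->
  {in `]0, 1[, continuous q} ->
  {in `[0, 1], continuous Q} ->
  {in `]0, 1[, forall t : R, is_derive t 1 Q (q t)} ->
  (\int[lebesgue_measure]_(u in `[Num.min e x, Num.max e x])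
     (q ((u - e) / (x - e)))%:E = (`|x - e| * (Q 1 - Q 0))%:E)%E.
Proof.
move=> ex q0 cq cQ dQ.
have xe0 : x - e != 0 by rewrite subr_eq0 eq_sym.
pose P u := (x - e) * Q ((u - e) / (x - e)).
rewrite (@ge0_open_continuous_FTC2 _ _ P); first last.
- move=> u /(affine_oo ex) /dQ; exact: is_derive_comp_affine.
- move=> u /(affine_cc ex) ut; rewrite /P; apply: cvgMl_tmp.
  apply: (@continuous_comp _ _ _ (fun u => (u - e) / (x - e)) Q u).
    exact: continuous_affine.
  exact: cQ.
- move=> u /(affine_oo ex) ut.
  apply: (@continuous_comp _ _ _ (fun u => (u - e) / (x - e)) q u).
    exact: continuous_affine.
  exact: cq.
- by move=> u /(affine_oo ex) /q0.
- by have [||/eqP] := ltgtP e x; rewrite // (negbTE ex).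
congr (_%:E); rewrite /P.
have [lt_ex|lt_xe|/eqP] := ltgtP e x; last by rewrite (negbTE ex).
- by rewrite divff// subrr mul0r ger0_norm ?subr_ge0 1?ltW//; ring.
- by rewrite divff// subrr mul0r ltr0_norm ?subr_lt0//; ring.
Qed.

Lemma ge0_integrable {R : realType} (D : set R) (g : R -> R) (r : R) :
  measurable D -> measurable_fun D g -> (forall u, D u -> 0 <= g u) ->
  (\int[lebesgue_measure]_(u in D) (g u)%:E = r%:E)%E ->
  lebesgue_measure.-integrable D (EFin \o g).
Proof.
move=> mD mg g0 Eg; apply/integrableP; split; first exact/measurable_EFinP.
apply: (@le_lt_trans _ _ r%:E); last exact: ltry.
rewrite -Eg le_eqVlt; apply/orP; left; apply/eqP; apply: eq_integral => u.
by rewrite inE => Du; rewrite /= ger0_norm// g0.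
Qed.

(** [H - f] and [H + f] have nonnegative derivative. *)
Lemma le_increment_deriv {R : realType} (f H df dH : R -> R) (c d : R) :
  c <= d ->
  {within `[c, d], continuous f} -> {within `[c, d], continuous H} ->
  {in `]c, d[, forall u : R, is_derive u 1 f (df u)} ->
  {in `]c, d[, forall u : R, is_derive u 1 H (dH u)} ->
  {in `]c, d[, forall u : R, `|df u| <= dH u} ->
  `|f d - f c| <= H d - H c.
Proof.
move=> cd cf cH df_ dH_ le_d.
have [<-|cd'] := eqVneq c d; first by rewrite !subrr normr0.
have ltcd : c < d by rewrite lt_neqAle cd'.
rewrite ler_norml; apply/andP; split.
- have [||w wcd] := @MVT R (H + f) (fun u => dH u + df u) c d ltcd.
  + by move=> u ucd; apply: is_deriveD; [exact: dH_|exact: df_].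
  + by move=> u; apply: continuousD; [exact: cH|exact: cf].
  rewrite !fctE => E.
  suff : 0 <= H d + f d - (H c + f c) by lra.
  rewrite E mulr_ge0 ?subr_ge0//.
  by have := le_d _ wcd; rewrite ler_norml => /andP[]; lra.
- have [||w wcd] := @MVT R (H - f) (fun u => dH u - df u) c d ltcd.
  + by move=> u ucd; apply: is_deriveB; [exact: dH_|exact: df_].
  + by move=> u; apply: continuousD; [exact: cH|apply: continuousN; exact: cf].
  rewrite !fctE => E.
  suff : 0 <= H d - f d - (H c - f c) by lra.
  rewrite E mulr_ge0 ?subr_ge0//.
  by have := le_d _ wcd; rewrite ler_norml => /andP[]; lra.
Qed.

(** * The Beta integral and the majorant of the increments *)

(** Euler's Beta function at [(p + 1, r + 1)]; with this shift the integrand is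
    continuous as soon as both exponents are positive. *)
Definition betaI {R : realType} (p r : R) : R :=
  \int[lebesgue_measure]_(v in `[0, 1]) (v `^ p * (1 - v) `^ r).

Lemma continuous_beta_integrand {R : realType} (p r : R) : 0 < p -> 0 < r ->
  continuous (fun v : R => `|v| `^ p * `|1 - v| `^ r).
Proof.
move=> p0 r0 v; apply: cvgM; first exact: continuous_normr_powR.
exact: continuous_normr_onem_powR.
Qed.

(** The primitive is based at [-1] and lives on [[-1, 2]], so that 0 and 1 are
    interior points, where differentiability gives two-sided continuity. *)
Lemma beta_primitive {R : realType} (p r : R) : 0 < p -> 0 < r ->
  exists J : R -> R,
    [/\ {in `[0, 1], continuous J}, J 0 = 0, J 1 = betaI p r &
      {in `]0, 1[, forall t : R, is_derive t 1 J (t `^ p * (1 - t) `^ r)}].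
Proof.
move=> p0 r0; pose g := fun v : R => `|v| `^ p * `|1 - v| `^ r.
have cg : continuous g by exact: continuous_beta_integrand.
have ig (a b : R) : lebesgue_measure.-integrable `[a, b] (EFin \o g).
  apply: continuous_compact_integrable; first exact: segment_compact.
  exact: continuous_subspaceT.
pose J0 (t : R) := (\int[lebesgue_measure]_(v in `[(-1)%R, t]) g v)%R.
have dJ0 (t : R) : 0 <= t <= 1 -> is_derive t 1 J0 (g t).
  move=> /andP[t0 t1].
  have t2 : t < 2 by lra.
  have t_1 : -1 < t by lra.
  have [] := @continuous_FTC1_closed R g (-1) t 2 t2 (ig _ _) t_1 (cg t).
  by move=> d; rewrite derive1E => E; apply: DeriveDef.
exists (fun t => J0 t - J0 0); split.
- move=> t; rewrite in_itv/= => t01.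
  apply: cvgB; last exact: cvg_cst.
  apply: differentiable_continuous; apply/derivable1_diffP.
  by have [] := dJ0 t t01.
- by rewrite subrr.
- rewrite /J0 Rintegral_itvB; [|exact: ig|by rewrite bnd_simp lerN10|by rewrite bnd_simp].
  rewrite Rintegral_itv_obnd_cbnd.
    apply: eq_Rintegral => v; rewrite inE/= in_itv/= => /andP[v0 v1].
    by rewrite /g !ger0_norm// subr_ge0.
  by apply: integrableS (ig 0 1) => //; exact: subset_itv_oc_cc.
- move=> t; rewrite in_itv/= => /andP[t0 t1].
  have t01 : 0 <= t <= 1 by rewrite !ltW.
  have := dJ0 t t01; rewrite /g !ger0_norm ?subr_ge0 ?ltW// => d.
  rewrite (_ : (fun t => _) = J0 - cst (J0 0))//.
  by apply: is_derive_eq; rewrite subr0.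
Qed.

(** The primitive, vanishing at 0, of [c0 + c1 * (A * t `^ s + B * (1 - t) `^ s)]
    on [[0, 1]]. *)
Definition majorant {R : realType} (s c0 c1 A B t : R) : R :=
  c0 * t + c1 * (A * `|t| `^ (s + 1) + B * (1 - `|1 - t| `^ (s + 1))) / (s + 1).

Lemma continuous_majorant {R : realType} (s c0 c1 A B : R) : 0 < s ->
  continuous (majorant s c0 c1 A B).
Proof.
move=> s0 t; have s1 : 0 < s + 1 by lra.
apply: cvgD; first by apply: cvgMl_tmp; exact: cvg_id.
apply: cvgMr_tmp; apply: cvgMl_tmp; apply: cvgD; apply: cvgMl_tmp.
  exact: continuous_normr_powR.
by apply: cvgB; [exact: cvg_cst|exact: continuous_normr_onem_powR].
Qed.

Lemma is_derive_majorant {R : realType} (s c0 c1 A B t : R) :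
  0 < s -> t \in `]0, 1[ ->
  is_derive t 1 (majorant s c0 c1 A B)
    (c0 + c1 * (A * t `^ s + B * (1 - t) `^ s)).
Proof.
move=> s0; rewrite in_itv/= => /andP[t0 t1].
have s1 : s + 1 != 0 by rewrite gt_eqF//; lra.
have := is_derive_normr_powR (s + 1) t0; rewrite addrK => d1.
have := is_derive_normr_onem_powR (s + 1) t1; rewrite addrK => d2.
rewrite (_ : majorant _ _ _ _ _ = c0 \*: id + (c1 / (s + 1)) \*:
  (A \*: (fun t : R => `|t| `^ (s + 1)) +
   B \*: (cst 1 - (fun t : R => `|1 - t| `^ (s + 1))))); last first.
  apply/funext => u; rewrite /majorant !fctE /GRing.scale/=.
  by congr (_ + _); rewrite mulrAC.
have d : is_derive t 1 (cst 1 - (fun t : R => `|1 - t| `^ (s + 1)))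
    (0 - - ((s + 1) * (1 - t) `^ s)) by exact: is_deriveB.
have := is_deriveD (is_deriveZ c0 (is_derive_id t 1))
  (is_deriveZ (c1 / (s + 1)) (is_deriveD (is_deriveZ A d1) (is_deriveZ B d))).
by move=> dE; apply: (is_derive_eq dE); rewrite /GRing.scale/=; field.
Qed.

Lemma majorant0 {R : realType} (s c0 c1 A B : R) : 0 < s ->
  majorant s c0 c1 A B 0 = 0.
Proof.
move=> s0; rewrite /majorant subr0 normr0 normr1 powR1 powR0; last by rewrite gt_eqF//; lra.
by rewrite subrr !mulr0 addr0 mulr0 mul0r addr0.
Qed.

Lemma majorant_ge0 {R : realType} (s c0 c1 A B : R) : 0 < s ->
  0 <= c0 -> 0 <= c1 -> 0 <= A -> 0 <= B ->
  {in `[0, 1], forall t : R, 0 <= majorant s c0 c1 A B t}.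
Proof.
move=> s0 c00 c10 A0 B0 t; rewrite in_itv/= => /andP[t0 t1].
have := @powR_onem_le R s t s0; rewrite t0 t1 => /(_ isT) h.
rewrite /majorant addr_ge0 ?mulr_ge0 ?invr_ge0 ?addr_ge0 ?mulr_ge0 ?powR_ge0 ?(ltW s0)//.
by rewrite ger0_norm ?subr_ge0//; lra.
Qed.

(** The term of [majorant] in [(1 - t) `^ (s + 1)] has in general no elementary
    primitive against [p * t `^ (p - 1)]; subtracting the derivative of
    [t `^ p * (1 - t) `^ (s + 1)] leaves [(s + 1) * t `^ p * (1 - t) `^ s], whose
    primitive is supplied by [beta_primitive]. *)
Lemma kernel_majorant_primitive {R : realType} (p s c0 c1 A B : R) :
  0 < p -> 0 < s ->
  exists Q : R -> R,
    [/\ {in `[0, 1], continuous Q},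
      {in `]0, 1[, forall t : R,
        is_derive t 1 Q (p * t `^ (p - 1) * majorant s c0 c1 A B t)} &
      Q 1 - Q 0 = c0 * (p / (p + 1)) +
        c1 * (A * (p / ((s + 1) * (p + s + 1))) +
              B * (1 / (s + 1) - betaI p s))].
Proof.
move=> p0 s0; have [J [cJ J0 J1 dJ]] := beta_primitive p0 s0.
have s1 : 0 < s + 1 by lra.
have p1 : 0 < p + 1 by lra.
have ps1 : 0 < p + s + 1 by lra.
pose Qf := (c0 * p / (p + 1)) \*: (fun t : R => `|t| `^ (p + 1)) + (c1 / (s + 1)) \*:
  ((A * p / (p + s + 1)) \*: (fun t : R => `|t| `^ (p + s + 1)) +
   B \*: ((fun t : R => `|t| `^ p) * (cst 1 - (fun t : R => `|1 - t| `^ (s + 1)))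
      - (s + 1) \*: J)).
have QE t : Qf t = c0 * p / (p + 1) * `|t| `^ (p + 1) + c1 / (s + 1) *
  (A * p / (p + s + 1) * `|t| `^ (p + s + 1) +
   B * (`|t| `^ p * (1 - `|1 - t| `^ (s + 1)) - (s + 1) * J t)) by [].
exists Qf; split.
- move=> t t01; have cJt : {for t, continuous J} by exact: cJ.
  apply: cvgD; first by apply: cvgMl_tmp; exact: continuous_normr_powR.
  apply: cvgMl_tmp; apply: cvgD.
    by apply: cvgMl_tmp; exact: continuous_normr_powR.
  apply: cvgMl_tmp; apply: cvgB; last by apply: cvgMl_tmp; exact: cJt.
  apply: cvgM; first exact: continuous_normr_powR.
  by apply: cvgB; [exact: cvg_cst|exact: continuous_normr_onem_powR].
- move=> t t01; have := t01; rewrite in_itv/= => /andP[t0 t1].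
  have d0 := dJ t t01.
  have := is_derive_normr_powR (p + 1) t0; rewrite addrK => d1.
  have := is_derive_normr_powR (p + s + 1) t0; rewrite addrK => d2.
  have := is_derive_normr_powR p t0 => d3.
  have := is_derive_normr_onem_powR (s + 1) t1; rewrite addrK => d4.
  have d5 : is_derive t 1 (cst 1 - (fun t : R => `|1 - t| `^ (s + 1)))
    (0 - - ((s + 1) * (1 - t) `^ s)) by exact: is_deriveB.
  have d6 := is_deriveB (is_deriveM d3 d5) (is_deriveZ (s + 1) d0).
  have d7 := is_deriveD (is_deriveZ (c0 * p / (p + 1)) d1)
    (is_deriveZ (c1 / (s + 1))
      (is_deriveD (is_deriveZ (A * p / (p + s + 1)) d2) (is_deriveZ B d6))).
  apply: (is_derive_eq d7).
  rewrite /majorant /GRing.scale/= !fctE !ger0_norm ?subr_ge0 1?ltW//.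
  have tp : t `^ p = t * t `^ (p - 1) by rewrite mulr_powRB1// ltW.
  have tps : t `^ (p + s) = t `^ (p - 1) * t `^ (s + 1).
    rewrite -powRD; first by congr (_ `^ _); ring.
    by apply/implyP => _; rewrite gt_eqF.
  rewrite tps tp; field.
  by rewrite !gt_eqF.
- rewrite !QE !(normr0, normr1) !subr0 subrr normr0 normr1 !powR1 J0 J1.
  rewrite !powR0 ?gt_eqF//; field.
  by rewrite !gt_eqF.
Qed.

(** The quantity is the integral of [p * t `^ (p - 1)] against
    [(1 - (1 - t) `^ (s + 1)) / (s + 1)], and the second factor is at least
    [t / (s + 1)].  Taking [c0 = - (s + 1)^-1] in the majorant subtracts exactly
    this lower bound, which contributes [p / (p + 1) / (s + 1)]. *)
Lemma beta_gap_gt0 {R : realType} (p s : R) : 0 < p -> 0 < s ->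
  0 < 1 / (s + 1) - betaI p s.
Proof.
move=> p0 s0.
have [Q [cQ dQ QE]] := kernel_majorant_primitive (- (s + 1)^-1) 1 0 1 p0 s0.
have s1 : 0 < s + 1 by lra.
have p1 : 0 < p + 1 by lra.
suff : 0 <= Q 1 - Q 0.
  rewrite QE mul0r add0r !mul1r => h.
  have : 0 < (s + 1)^-1 * (p / (p + 1)) by rewrite mulr_gt0 ?invr_gt0// divr_gt0.
  by lra.
have [|c] := @MVT R Q _ 0 1 ltr01 dQ.
  by apply: continuous_in_subspaceT => t; rewrite inE => /cQ.
rewrite in_itv/= => /andP[c0 c1] ->.
rewrite subr0 mulr1 mulr_ge0// ?mulr_ge0 ?powR_ge0 ?(ltW p0)//.
rewrite /majorant mul0r add0r !mul1r mulNr [_^-1 * c]mulrC -mulrN1 addrC.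
rewrite ger0_norm; last by rewrite subr_ge0 ltW.
have h : (1 - c) `^ (s + 1) <= 1 - c by apply: powR_onem_le; rewrite // !ltW.
have -> : (1 - (1 - c) `^ (s + 1)) / (s + 1) + c / (s + 1) * -1 =
  (1 - c - (1 - c) `^ (s + 1)) / (s + 1) by ring.
by rewrite divr_ge0 ?subr_ge0// (ltW s1).
Qed.

(** * The Gamma function *)

Lemma tonelli_triangle {R : realType} (k : R * R -> R) :
  measurable_fun [set: R * R] k -> (forall z, 0 <= k z) ->
  (\int[lebesgue_measure]_(w in `]0%R, +oo[)
     \int[lebesgue_measure]_(u in `]0%R, w]) (k (w, u))%:E =
   \int[lebesgue_measure]_(u in `]0%R, +oo[)
     \int[lebesgue_measure]_(w in `[u, +oo[) (k (w, u))%:E)%E.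
Proof.
move=> mk k0.
pose T := [set z : R * R | 0 < z.2 /\ z.2 <= z.1].
have mT : measurable T.
  rewrite (_ : T = (snd @^-1` `]0%R, +oo[%classic) `&`
    ((fun z : R * R => z.1 - z.2) @^-1` `[0%R, +oo[%classic)).
    apply: measurableI.
      by rewrite -[X in measurable X]setTI; exact: measurable_snd.
    rewrite -[X in measurable X]setTI; apply: measurable_funB => //.
  apply/seteqP; split=> z; rewrite /T/= !in_itv/= !andbT subr_ge0.
    by case.
  by [].
pose f : R * R -> \bar R := (EFin \o k) \_ T.
have mf : measurable_fun setT f.
  by apply/(measurable_restrictT _ mT)/measurable_funTS/measurable_EFinP.
have f0 z : (0 <= f z)%E by apply: erestrict_ge0 => {}z _; rewrite lee_fin.
have fT w u : (0 < u) && (u <= w) -> f (w, u) = (k (w, u))%:E.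
  by move=> /andP[? ?]; rewrite /f patchE mem_set.
have fN w u : ~~ ((0 < u) && (u <= w)) -> f (w, u) = 0%E.
  by move=> h; rewrite /f patchE memNset// => -[/= ? ?]; case/andP: h.
transitivity (\int[lebesgue_measure]_w \int[lebesgue_measure]_u f (w, u))%E.
  rewrite integral_mkcond; apply: eq_integral => w _.
  rewrite patchE; case: ifPn => [|]; rewrite ?inE ?notin_setE/= in_itv/= andbT.
    move=> w0; rewrite integral_mkcond; apply: eq_integral => u _.
    rewrite patchE; case: ifPn; rewrite ?inE ?notin_setE/= in_itv/=.
      by move=> /fT.
    by move=> /negP /fN.
  move=> /negP; rewrite -leNgt => w0; rewrite integral0_eq// => u _.
  by apply: fN; apply/negP => /andP[]; lra.
rewrite (@fubini_tonelli _ _ _ _ R lebesgue_measure lebesgue_measure f mf f0).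
rewrite [RHS]integral_mkcond; apply: eq_integral => u _.
rewrite patchE; case: ifPn => [|]; rewrite ?inE ?notin_setE/= in_itv/= andbT.
  move=> u0; rewrite [RHS]integral_mkcond; apply: eq_integral => w _.
  rewrite patchE; case: ifPn; rewrite ?inE ?notin_setE/= in_itv/= andbT.
    by move=> uw; rewrite fT// u0.
  by move=> uw; rewrite fN// negb_and; apply/orP; right; apply/negP.
move=> /negP; rewrite -leNgt => u0; rewrite integral0_eq// => w _.
by apply: fN; apply/negP => /andP[]; lra.
Qed.

Lemma integral_expRN_tail {R : realType} (c u : R) : 0 < c ->
  (\int[lebesgue_measure]_(w in `[u, +oo[) (expR (- (c * w)))%:E =
   (c^-1 * expR (- (c * u)))%:E)%E.
Proof.
move=> c0.
have dF (t : R) : is_derive t 1 (fun w => - (c^-1 * expR (- (c * w)))) (expR (- (c * t))).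
  rewrite (_ : (fun w => _) = (- c^-1) \*: (expR \o (fun w : R => - (c * w)))); last first.
    by apply/funext => w /=; rewrite /GRing.scale/= mulNr.
  have d1 : is_derive t 1 (fun w : R => - (c * w)) (- c).
    rewrite (_ : (fun w : R => _) = (- c) \*: id); last first.
      by apply/funext => w /=; rewrite /GRing.scale/= mulNr.
    by apply: is_derive_eq; rewrite /GRing.scale/= mulr1.
  have d2 := @is_derive_expR R (- (c * t)).
  have d3 := @is_derive1_comp _ expR (fun w => - (c * w)) t _ _ d2 d1.
  apply: is_derive_eq; rewrite /GRing.scale/=; field.
  by rewrite gt_eqF.
rewrite (@ge0_continuous_FTC2y _ _ (fun w => - (c^-1 * expR (- (c * w)))) _ 0).
- by rewrite sub0e EFinN oppeK.
- by move=> w _; exact: expR_ge0.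
- apply: continuous_subspaceT => w.
  apply: (@continuous_comp _ _ _ (fun w => - (c * w)) expR w).
    by apply: cvgN; apply: cvgMl_tmp; exact: cvg_id.
  exact: continuous_expR.
- rewrite -oppr0; apply: cvgN; rewrite -(mulr0 c^-1); apply: cvgMl_tmp.
  apply: (@cvg_comp _ _ _ (fun w : R => c * w) (fun w => expR (- w)) _ +oo).
    exact: gt0_cvgMry.
  exact: cvgr_expR.
- by move=> w _; have [] := dF w.
- apply: cvg_at_right_filter.
  suff : {for u, continuous (fun w => - (c^-1 * expR (- (c * w))))} by [].
  by apply/differentiable_continuous/derivable1_diffP; have [] := dF u.
- by move=> w _; rewrite derive1E; have [_ ->] := dF w.
Qed.

(** The Gamma integral with values in the extended reals, so that Tonelli applies
    before finiteness is known. *)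
Definition eGamma {R : realType} (p : R) : \bar R :=
  (\int[lebesgue_measure]_(u in `]0%R, +oo[) (expR (- u) * u `^ (p - 1))%:E)%E.

Lemma measurable_Gamma_integrand {R : realType} (p : R) (D : set R) :
  measurable_fun D (fun u : R => expR (- u) * u `^ (p - 1)).
Proof.
apply: measurable_funTS; apply: measurable_funM; last exact: measurable_powR.
by apply: measurableT_comp.
Qed.

Lemma eGamma_ge0 {R : realType} (p : R) : (0 <= eGamma p)%E.
Proof.
by apply: integral_ge0 => u _; rewrite lee_fin mulr_ge0 ?expR_ge0 ?powR_ge0.
Qed.

Lemma integral_powR0 {R : realType} (p w : R) : 0 < p -> 0 < w ->
  (\int[lebesgue_measure]_(u in `]0%R, w]) (p * u `^ (p - 1))%:E
   = (w `^ p)%:E)%E.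
Proof.
move=> p0 w0.
have mf : measurable_fun `]0, w]%classic (fun u : R => (p * u `^ (p - 1))%:E).
  apply/measurable_EFinP/measurable_funTS/measurable_funM => //.
rewrite integral_itv_obnd_cbnd//.
rewrite (@ge0_open_continuous_FTC2 _ _ (fun u => `|u| `^ p))//.
- by rewrite normr0 powR0 ?gt_eqF// subr0 gtr0_norm.
- by move=> u _; rewrite mulr_ge0 ?powR_ge0// ltW.
- move=> u; rewrite in_itv/= => /andP[u0 _].
  apply: cvgMl_tmp; exact: continuous_at_powR.
- by move=> u _; exact: continuous_normr_powR.
- by move=> u; rewrite in_itv/= => /andP[u0 _]; exact: is_derive_normr_powR.
Qed.

(** Replace [w `^ p] by the integral of [p * u `^ (p - 1)] over [0 < u <= w] and
    exchange the integrals; the inner one becomes the tail [expR (- u)]. *)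
Lemma eGammaD1 {R : realType} (p : R) : 0 < p ->
  (eGamma (p + 1) = p%:E * eGamma p)%E.
Proof.
move=> p0; rewrite /eGamma addrK.
pose k (z : R * R) := expR (- z.1) * (p * z.2 `^ (p - 1)).
have mk : measurable_fun setT k.
  apply: measurable_funM.
    by apply: (@measurableT_comp _ _ _ _ _ _ expR) => //; exact: measurableT_comp.
  apply: measurable_funM => //.
  exact: (measurableT_comp (measurable_powR _)).
have k0 z : 0 <= k z.
  by rewrite mulr_ge0 ?expR_ge0// mulr_ge0 ?powR_ge0// ltW.
transitivity (\int[lebesgue_measure]_(w in `]0%R, +oo[)
     \int[lebesgue_measure]_(u in `]0%R, w]) (k (w, u))%:E)%E.
  apply: eq_integral => w; rewrite inE/= in_itv/= andbT => w0.
  under [RHS]eq_integral => u _ do rewrite /k/= EFinM.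
  rewrite ge0_integralZl//=.
  - by rewrite integral_powR0// EFinM.
  - by apply/measurable_EFinP/measurable_funTS/measurable_funM.
  - by move=> u _; rewrite lee_fin mulr_ge0 ?powR_ge0// ltW.
rewrite tonelli_triangle//.
transitivity (\int[lebesgue_measure]_(u in `]0%R, +oo[)
   (p%:E * (expR (- u) * u `^ (p - 1))%:E))%E.
  apply: eq_integral => u; rewrite inE/= in_itv/= andbT => u0.
  under eq_integral => w _ do rewrite /k/= mulrC -[w in expR (- w)]mul1r EFinM.
  rewrite ge0_integralZl//=.
  - by rewrite integral_expRN_tail// invr1 !mul1r -!EFinM; congr (_%:E); ring.
  - apply/measurable_EFinP/measurable_funTS.
    by apply: (@measurableT_comp _ _ _ _ _ _ expR) => //; exact: measurableT_comp.
  - by rewrite lee_fin mulr_ge0 ?powR_ge0// ltW.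
rewrite ge0_integralZl//=.
- by apply/measurable_EFinP; exact: measurable_Gamma_integrand.
- by move=> u _; rewrite lee_fin mulr_ge0 ?expR_ge0 ?powR_ge0.
- by rewrite lee_fin ltW.
Qed.

(** This is [ln y < y] at [y = w / (2 * p)]. *)
Lemma powR_le_expR_half {R : realType} (p w : R) : 0 < p -> 0 < w ->
  w `^ p <= expR (p * ln (2 * p)) * expR (w / 2).
Proof.
move=> p0 w0; rewrite /powR gt_eqF// -expRD ler_expR.
have y0 : 0 < w / (2 * p) by rewrite divr_gt0// mulr_gt0.
have := ln_sublinear y0; rewrite ln_div ?posrE ?mulr_gt0// => h.
have : p * (ln w - ln (2 * p)) <= p * (w / (2 * p)) by rewrite ler_pM2l// ltW.
have -> : p * (w / (2 * p)) = w / 2 by field; rewrite gt_eqF.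
by lra.
Qed.

(** Only the arguments [p + 1] with [p > 0] are covered here: there the integrand
    has no singularity at 0.  The recurrence transfers finiteness to all
    [p > 0]. *)
Lemma eGammaD1_lty {R : realType} (p : R) : 0 < p -> (eGamma (p + 1) < +oo)%E.
Proof.
move=> p0; pose C := expR (p * ln (2 * p)).
apply: (@le_lt_trans _ _ (\int[lebesgue_measure]_(u in `]0%R, +oo[)
    (C%:E * (expR (- (2^-1 * u)))%:E))%E); last first.
  have me D : measurable_fun D (fun u : R => (expR (- (2^-1 * u)))%:E).
    apply/measurable_EFinP/measurable_funTS.
    by apply: (@measurableT_comp _ _ _ _ _ _ expR) => //; exact: measurableT_comp.
  rewrite ge0_integralZl//=; [|exact: me|by rewrite lee_fin expR_ge0].
  rewrite integral_itv_obnd_cbnd; last exact: me.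
  by rewrite integral_expRN_tail// -EFinM ltry.
have mg D : measurable_fun D (fun u : R => (C%:E * (expR (- (2^-1 * u)))%:E)%E).
  apply/measurable_EFinP/measurable_funTS; apply: measurable_funM => //.
  by apply: (@measurableT_comp _ _ _ _ _ _ expR) => //; exact: measurableT_comp.
rewrite /eGamma; apply: ge0_le_integral => //.
- by move=> u _; rewrite lee_fin mulr_ge0 ?expR_ge0 ?powR_ge0.
- by apply/measurable_EFinP; exact: measurable_Gamma_integrand.
- exact: mg.
- move=> u /=; rewrite in_itv/= andbT => u0; rewrite addrK lee_fin.
  rewrite (le_trans (ler_wpM2l (expR_ge0 _) (powR_le_expR_half p0 u0)))//.
  rewrite mulrCA ler_wpM2l ?expR_ge0// -expRD ler_expR; lra.
Qed.

Lemma eGammaD1_gt0 {R : realType} (p : R) : 0 < p -> (0 < eGamma (p + 1))%E.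
Proof.
move=> p0; apply: (@lt_le_trans _ _ (\int[lebesgue_measure]_(u in `[1%R, 2%R])
  (expR (- 2))%:E)%E).
  rewrite integral_cst//= lebesgue_measure_itv/= lte_fin ltr1n -EFinB.
  by rewrite -EFinM lte_fin mulr_gt0 ?expR_gt0// subr_gt0 ltr1n.
apply: (@le_trans _ _ (\int[lebesgue_measure]_(u in `[1%R, 2%R])
  (expR (- u) * u `^ (p + 1 - 1))%:E)%E).
  apply: ge0_le_integral => //.
  - by apply/measurable_EFinP; exact: measurable_Gamma_integrand.
  - move=> u /=; rewrite in_itv/= => /andP[u1 u2]; rewrite lee_fin addrK.
    rewrite -[leLHS]mulr1 ler_pM ?expR_ge0 ?ler_expR ?lerN2//.
    by rewrite -(powRr0 u) ler_powR// ltW.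
apply: ge0_subset_integral => //.
- by apply/measurable_EFinP; exact: measurable_Gamma_integrand.
- by move=> u _; rewrite lee_fin mulr_ge0 ?expR_ge0 ?powR_ge0.
- by move=> u /=; rewrite !in_itv/= andbT => /andP[u1 _]; lra.
Qed.

Lemma eGamma_fin_num {R : realType} (p : R) : 0 < p -> eGamma p \is a fin_num.
Proof.
move=> p0; rewrite ge0_fin_numE ?eGamma_ge0//.
have := eGammaD1_lty p0; rewrite eGammaD1//.
by case: (eGamma p) => [r|//|]; rewrite ?ltry// gt0_muley// ltxx.
Qed.

Lemma GammaE {R : realType} (p : R) : 0 < p -> (Gamma p)%:E = eGamma p.
Proof. by move=> p0; rewrite -[RHS]fineK ?eGamma_fin_num. Qed.

Lemma GammaD1 {R : realType} (p : R) : 0 < p -> Gamma (p + 1) = p * Gamma p.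
Proof.
move=> p0; have p1 : 0 < p + 1 by lra.
by have := eGammaD1 p0; rewrite -(GammaE p0) -(GammaE p1) -EFinM => -[].
Qed.

Lemma Gamma_gt0 {R : realType} (p : R) : 0 < p -> 0 < Gamma p.
Proof.
move=> p0; have := eGammaD1_gt0 p0.
by rewrite eGammaD1// -GammaE// -EFinM lte_fin pmulr_rgt0.
Qed.

Lemma eGamma_shift {R : realType} (r u : R) : 0 < r ->
  (\int[lebesgue_measure]_(w in `[u, +oo[) (expR (- (w - u)) * (w - u) `^ r)%:E
   = eGamma (r + 1))%E.
Proof.
move=> r0; rewrite /eGamma addrK.
pose G := fun v : R => expR (- v) * `|v| `^ r.
have cG : continuous G.
  move=> v; apply: cvgM; last exact: continuous_normr_powR.
  apply: (@continuous_comp _ _ _ (fun v : R => - v) expR v).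
    by apply: cvgN; exact: cvg_id.
  exact: continuous_expR.
have d1 (w : R) : is_derive w 1 (fun w : R => w - u) 1.
  rewrite (_ : (fun w : R => w - u) = id - cst u)//.
  by apply: is_derive_eq; rewrite subr0.
have dF : derive1 (fun w : R => w - u) = cst 1.
  by apply/funext => w; rewrite derive1E; case: (d1 w).
have cF : continuous (fun w : R => w - u).
  by move=> w; apply: cvgB; [exact: cvg_id|exact: cvg_cst].
have := @increasing_ge0_integration_by_substitutiony R (fun w => w - u) G u.
rewrite subrr => H.
transitivity (\int[lebesgue_measure]_(v in `[0%R, +oo[) (G v)%:E)%E; last first.
  rewrite -integral_itv_obnd_cbnd; last first.
    apply/measurable_EFinP/measurable_funTS; exact: continuous_measurable_fun.
  apply: eq_integral => v; rewrite inE/= in_itv/= andbT => v0.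
  by rewrite /G gtr0_norm.
rewrite H.
- apply: eq_integral => w; rewrite inE/= in_itv/= andbT => uw.
  by rewrite !fctE dF mulr1 /G ger0_norm// subr_ge0.
- by move=> w z _ _; rewrite ltrD2r.
- by rewrite dF => w _; exact: cvg_cst.
- by rewrite dF; exact: is_cvg_cst.
- by rewrite dF; exact: is_cvg_cst.
- split.
    by move=> w _; case: (d1 w).
  by apply: cvg_at_right_filter; exact: cF.
- apply/cvgryPge => A; near=> w; rewrite lerBrDr; near: w.
  by apply: nbhs_pinfty_ge; exact: num_real.
- exact: continuous_subspaceT.
- by move=> w _; rewrite mulr_ge0 ?expR_ge0 ?powR_ge0.
Unshelve. all: by end_near. Qed.

Lemma integral_beta_scale {R : realType} (p r w : R) : 0 < p -> 0 < r -> 0 < w ->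
  (\int[lebesgue_measure]_(u in `]0%R, w]) (u `^ p * (w - u) `^ r)%:E
   = (w `^ (p + r + 1) * betaI p r)%:E)%E.
Proof.
move=> p0 r0 w0; have [J [cJ J0 J1 dJ]] := beta_primitive p0 r0.
pose q t : R := w `^ (p + r) * (t `^ p * (1 - t) `^ r).
have w_neq0 : 0 != w by rewrite lt_eqF.
have mf : measurable_fun setT (fun u : R => u `^ p * (w - u) `^ r).
  apply: measurable_funM => //.
  apply: (@measurableT_comp _ _ _ _ _ _ (fun t : R => t `^ r)) => //.
  exact: measurable_funB.
rewrite integral_itv_obnd_cbnd; last exact/measurable_EFinP/measurable_funTS.
have := @integral_affine _ 0 w q (fun t => w `^ (p + r) * J t) w_neq0.
rewrite (min_l (ltW w0)) (max_r (ltW w0)) subr0 J0 J1 mulr0 subr0 gtr0_norm//.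
have -> : w `^ (p + r + 1) * betaI p r = w * (w `^ (p + r) * betaI p r).
  have -> : w `^ (p + r + 1) = w `^ (p + r) * w.
    by rewrite powRD ?(gt_eqF w0) ?implybT// powRr1// ltW.
  by ring.
move=> <-.
- apply: eq_integral => u; rewrite inE/= in_itv/= => /andP[u0 uw].
  rewrite /q subr0; have -> : 1 - u / w = (w - u) / w by field; rewrite gt_eqF.
  have quot y m : 0 <= y -> (y / w) `^ m = y `^ m / w `^ m.
    move=> y0; rewrite powRM ?invr_ge0 ?(ltW w0)// -powR_inv1 ?(ltW w0)//.
    by rewrite powRAC powR_inv1 ?powR_ge0.
  rewrite !quot ?subr_ge0 ?(ltW u0)// powRD ?(gt_eqF w0) ?implybT//; congr (_%:E).
  by field; rewrite !gt_eqF ?powR_gt0.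
- by move=> t _; rewrite !mulr_ge0 ?powR_ge0.
- move=> t; rewrite in_itv/= => /andP[t0 t1].
  apply: cvgMl_tmp; apply: cvgM.
    exact: continuous_at_powR.
  apply: (@continuous_comp _ _ _ (fun t : R => 1 - t) (fun u : R => u `^ r) t).
    by apply: cvgB; [exact: cvg_cst|exact: cvg_id].
  by apply: continuous_at_powR; rewrite subr_gt0.
- by move=> t t01; apply: cvgMl_tmp; exact: cJ.
- move=> t t01; have d := dJ t t01.
  rewrite (_ : (fun t => _) = w `^ (p + r) \*: J)//.
  by apply: is_derive_eq.
Qed.

(** The convolution proof.  Integrating
    [expR (- w) * u `^ p * (w - u) `^ r] over the triangle [0 < u <= w] first in
    [u] gives [w `^ (p + r + 1)] times the Beta integral by scaling; first in
    [w] it gives [expR (- u) * u `^ p] times a full Gamma integral by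
    translation. *)
Lemma Gamma_beta {R : realType} (p r : R) : 0 < p -> 0 < r ->
  Gamma (p + 1) * Gamma (r + 1) = betaI p r * Gamma (p + r + 2).
Proof.
move=> p0 r0.
have p1 : 0 < p + 1 by lra.
have r1 : 0 < r + 1 by lra.
have pr2 : 0 < p + r + 2 by lra.
suff : (eGamma (p + 1) * eGamma (r + 1) =
    (betaI p r)%:E * eGamma (p + r + 2))%E.
  by rewrite -(GammaE p1) -(GammaE r1) -(GammaE pr2) -!EFinM => -[].
pose k (z : R * R) := expR (- z.1) * (z.2 `^ p * (z.1 - z.2) `^ r).
have mk : measurable_fun setT k.
  apply: measurable_funM.
    by apply: (@measurableT_comp _ _ _ _ _ _ expR) => //; exact: measurableT_comp.
  apply: measurable_funM.
    by apply: (@measurableT_comp _ _ _ _ _ _ (fun t : R => t `^ p)).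
  apply: (@measurableT_comp _ _ _ _ _ _ (fun t : R => t `^ r)) => //.
  exact: measurable_funB.
have k0 z : 0 <= k z by rewrite mulr_ge0 ?expR_ge0// mulr_ge0 ?powR_ge0.
have inner_u : (\int[lebesgue_measure]_(w in `]0%R, +oo[)
     \int[lebesgue_measure]_(u in `]0%R, w]) (k (w, u))%:E =
   (betaI p r)%:E * eGamma (p + r + 2))%E.
  have b0 : 0 <= betaI p r.
    by apply: Rintegral_ge0 => v _; rewrite mulr_ge0 ?powR_ge0.
  rewrite /eGamma (_ : p + r + 2 - 1 = p + r + 1); last by ring.
  rewrite -ge0_integralZl//=; last 2 first.
  - have := @measurable_Gamma_integrand R (p + r + 2) `]0, +oo[%classic.
    rewrite (_ : p + r + 2 - 1 = p + r + 1); last by ring.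
    by move=> ?; exact/measurable_EFinP.
  - by move=> u _; rewrite lee_fin mulr_ge0 ?expR_ge0 ?powR_ge0.
  apply: eq_integral => w; rewrite inE/= in_itv/= andbT => w0.
  under eq_integral => u _ do rewrite /k/= EFinM.
  rewrite ge0_integralZl//=.
  - by rewrite integral_beta_scale// -!EFinM; congr (_%:E); ring.
  - apply/measurable_EFinP/measurable_funTS; apply: measurable_funM => //.
    apply: (@measurableT_comp _ _ _ _ _ _ (fun t : R => t `^ r)) => //.
    exact: measurable_funB.
  - by move=> u _; rewrite lee_fin mulr_ge0 ?powR_ge0.
apply: etrans (etrans (esym (tonelli_triangle mk k0)) inner_u).
rewrite muleC {2}/eGamma addrK -ge0_integralZl//=; last 3 first.
- have := @measurable_Gamma_integrand R (p + 1) `]0, +oo[%classic.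
  by rewrite addrK => ?; exact/measurable_EFinP.
- by move=> u _; rewrite lee_fin mulr_ge0 ?expR_ge0 ?powR_ge0.
- exact: eGamma_ge0.
apply: eq_integral => u; rewrite inE/= in_itv/= andbT => u0.
rewrite -(eGamma_shift u r0) muleC -ge0_integralZl//=.
- apply: eq_integral => w _; rewrite /k/= -EFinM; congr (_%:E).
  have -> : expR (- w) = expR (- u) * expR (- (w - u)).
    by rewrite -expRD; congr expR; ring.
  by ring.
- apply/measurable_EFinP/measurable_funTS; apply: measurable_funM.
    apply: (@measurableT_comp _ _ _ _ _ _ expR) => //; apply: measurableT_comp => //.
    exact: measurable_funB.
  apply: (@measurableT_comp _ _ _ _ _ _ (fun t : R => t `^ r)) => //.
  exact: measurable_funB.
- by move=> w _; rewrite lee_fin mulr_ge0 ?expR_ge0 ?powR_ge0.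
- by rewrite lee_fin mulr_ge0 ?expR_ge0 ?powR_ge0.
Qed.

(** * The estimate at one endpoint *)

(** The function [v => (x - e) * majorant ((v - e) / (x - e))] has derivative at
    least [|g|], vanishes at [e], and is increasing for either sign of
    [x - e]. *)
Lemma increment_le_majorant {R : realType} (f g : R -> R) (e x s c0 c1 A B : R) :
  e != x -> 0 < s ->
  {within `[Num.min e x, Num.max e x], continuous f} ->
  {in `]Num.min e x, Num.max e x[, forall u : R, is_derive u 1 f (g u)} ->
  {in `]Num.min e x, Num.max e x[, forall u : R, `|g u| <=
     c0 + c1 * (A * ((u - e) / (x - e)) `^ s + B * (1 - (u - e) / (x - e)) `^ s)} ->
  {in `[Num.min e x, Num.max e x], forall u : R,
    `|f u - f e| <= `|x - e| * majorant s c0 c1 A B ((u - e) / (x - e))}.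
Proof.
move=> ex s0 cf df gle u uD.
pose H v := (x - e) * majorant s c0 c1 A B ((v - e) / (x - e)).
pose dH v := c0 + c1 * (A * ((v - e) / (x - e)) `^ s + B * (1 - (v - e) / (x - e)) `^ s).
have cH : continuous H.
  move=> v; apply: cvgMl_tmp.
  apply: (@continuous_comp _ _ _ (fun u => (u - e) / (x - e)) (majorant s c0 c1 A B) v).
    exact: continuous_affine.
  exact: continuous_majorant.
have He : H e = 0 by rewrite /H subrr mul0r majorant0// mulr0.
have dHP : {in `]Num.min e x, Num.max e x[, forall v : R, is_derive v 1 H (dH v)}.
  move=> v /(affine_oo ex) vt; apply: (is_derive_comp_affine ex).
  exact: is_derive_majorant.
have inc c d : c <= d -> Num.min e x <= c -> d <= Num.max e x ->
    `|f d - f c| <= H d - H c.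
  move=> cd mc dM.
  have sub : `]c, d[%classic `<=` `]Num.min e x, Num.max e x[%classic.
    by apply: subset_itv; rewrite bnd_simp.
  apply: (@le_increment_deriv R f H g dH).
  - exact: cd.
  - apply: continuous_subspaceW cf; apply: subset_itv; rewrite bnd_simp //.
  - exact: continuous_subspaceT.
  - by move=> v /sub /df.
  - by move=> v /sub /dHP.
  - by move=> v /sub /gle.
move: uD; rewrite in_itv/=.
have [lt_ex|lt_xe|/eqP] := ltgtP e x; last by rewrite (negbTE ex).
- move=> /andP[eu ux]; have := inc e u eu.
  rewrite (min_l (ltW lt_ex)) (max_r (ltW lt_ex)) lexx => /(_ isT ux).
  by rewrite He subr0 /H [`|x - e|]gtr0_norm ?subr_gt0.
- move=> /andP[xu ue]; have := inc u e ue.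
  rewrite (min_r (ltW lt_xe)) (max_l (ltW lt_xe)) lexx => /(_ xu isT).
  by rewrite He sub0r /H distrC [`|x - e|]ltr0_norm ?subr_lt0// mulNr.
Qed.

(** Since [\int p * |u - e| `^ (p - 1) = |x - e| `^ p], the quantity inside the
    absolute value is [p * \int |u - e| `^ (p - 1) * (f e - f u)], so that the
    pointwise bound on the increments can be integrated against the kernel.
    The integrability of the kernel times [f] also comes from this bound. *)
Lemma one_sided_bound {R : realType} (f : R -> R) (e x p s c0 c1 A B : R) :
  let D := `[Num.min e x, Num.max e x]%classic in
  e != x -> 0 < p -> 0 < s ->
  {in `[0, 1], forall t : R, 0 <= majorant s c0 c1 A B t} ->
  measurable_fun D f ->
  (forall u, D u ->
    `|f u - f e| <= `|x - e| * majorant s c0 c1 A B ((u - e) / (x - e))) ->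
  `| `|x - e| `^ p * f e -
     p * \int[lebesgue_measure]_(u in D) (`|u - e| `^ (p - 1) * f u) | <=
  `|x - e| `^ (p + 1) * (c0 * (p / (p + 1)) +
        c1 * (A * (p / ((s + 1) * (p + s + 1))) +
              B * (1 / (s + 1) - betaI p s))).
Proof.
move=> D ex p0 s0 maj0 mf fH.
have [Q [cQ dQ <-]] := kernel_majorant_primitive c0 c1 A B p0 s0.
set L := `|x - e|; set maj := majorant s c0 c1 A B in maj0 fH dQ *.
have L0 : 0 < L by rewrite normr_gt0 subr_eq0 eq_sym.
(* [k] is the kernel [p * |u - e| `^ (p - 1)] divided by [L `^ (p - 1)]. *)
pose T (u : R) := (u - e) / (x - e).
pose k (u : R) := p * T u `^ (p - 1).
have mD : measurable D by exact: measurable_itv.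
have mT : measurable_fun setT T.
  by apply: continuous_measurable_fun; exact: continuous_affine.
have mk : measurable_fun setT k.
  apply: measurable_funM => //.
  exact: (@measurableT_comp _ _ _ _ _ _ (fun t : R => t `^ (p - 1))).
have mm : measurable_fun setT (maj \o T).
  apply: measurableT_comp => //; apply: continuous_measurable_fun.
  exact: continuous_majorant.
have k0 u : 0 <= k u by rewrite mulr_ge0 ?powR_ge0// ltW.
have cp : {in `]0, 1[, continuous (fun t : R => p * t `^ (p - 1))}.
  move=> t; rewrite in_itv/= => /andP[t0 t1]; apply: cvgMl_tmp.
  exact: continuous_at_powR.
have E1 : (\int[lebesgue_measure]_(u in D) (k u)%:E = L%:E)%E.
  have := @integral_affine R e x (fun t => p * t `^ (p - 1)) (fun t => `|t| `^ p) ex.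
  rewrite normr0 normr1 powR1 powR0 ?gt_eqF// subr0 mulr1; apply => //.
  - by move=> t _; rewrite mulr_ge0 ?powR_ge0// ltW.
  - by move=> t _; exact: continuous_normr_powR.
  - by move=> t; rewrite in_itv/= => /andP[t0 _]; exact: is_derive_normr_powR.
have E2 : (\int[lebesgue_measure]_(u in D) (k u * maj (T u))%:E =
    (L * (Q 1 - Q 0))%:E)%E.
  apply: (@integral_affine R e x (fun t => p * t `^ (p - 1) * maj t) Q ex) => //.
  - move=> t t01; rewrite mulr_ge0 ?maj0//; last exact: subset_itv_oo_cc.
    by rewrite mulr_ge0 ?powR_ge0// ltW.
  - move=> t t01; apply: cvgM; first exact: cp.
    exact: continuous_majorant.
have TD u : D u -> T u \in `[0, 1] by move=> Du; exact: affine_cc.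
have i1 : lebesgue_measure.-integrable D (EFin \o k).
  by apply: ge0_integrable E1 => //; exact: measurable_funTS.
have i2 : lebesgue_measure.-integrable D (EFin \o (fun u => k u * maj (T u))).
  apply: ge0_integrable E2 => //; first by apply: measurable_funTS; exact: measurable_funM.
  by move=> u /TD /maj0 ?; rewrite mulr_ge0.
have ie : lebesgue_measure.-integrable D (EFin \o (fun u => f e * k u)).
  exact: (@integrableZl _ _ _ lebesgue_measure D mD (f e) (EFin \o k)).
have i2L : lebesgue_measure.-integrable D (EFin \o (fun u => L * (k u * maj (T u)))).
  exact: (@integrableZl _ _ _ lebesgue_measure D mD L (EFin \o (fun u => k u * maj (T u)))).
have idiff : lebesgue_measure.-integrable D (EFin \o (fun u => f e * k u - k u * f u)).
  apply: le_integrable i2L => //.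
    apply/measurable_EFinP; apply: measurable_funB; apply: measurable_funM => //;
      exact: measurable_funTS.
  move=> u Du; rewrite lee_fin [f e * _]mulrC -mulrBr normrM (ger0_norm (k0 u)).
  rewrite [leRHS]ger0_norm; last first.
    by rewrite mulr_ge0 ?(ltW L0)// mulr_ge0// maj0// TD.
  by rewrite mulrCA ler_wpM2l// distrC fH.
have ik : lebesgue_measure.-integrable D (EFin \o (fun u => k u * f u)).
  have := @integrableB _ _ _ lebesgue_measure D mD _ _ ie idiff.
  rewrite (_ : (fun u => _) = EFin \o (fun u => k u * f u))//.
  by apply/funext => u /=; rewrite -EFinB; congr (_%:E); ring.
have R1 : \int[lebesgue_measure]_(u in D) k u = L by rewrite /Rintegral E1.
have R2 : \int[lebesgue_measure]_(u in D) (k u * maj (T u)) = L * (Q 1 - Q 0).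
  by rewrite /Rintegral E2.
have main : `|f e * L - \int[lebesgue_measure]_(u in D) (k u * f u)| <=
    L * (L * (Q 1 - Q 0)).
  have -> : f e * L = \int[lebesgue_measure]_(u in D) (f e * k u).
    by rewrite RintegralZl// R1.
  have -> : L * (L * (Q 1 - Q 0)) =
      \int[lebesgue_measure]_(u in D) (L * (k u * maj (T u))).
    by rewrite RintegralZl// R2.
  rewrite -RintegralB//.
  apply: le_trans (le_normr_Rintegral _ _) _ => //.
  apply: le_Rintegral => //; first exact: integrable_norm.
  move=> u Du; rewrite [f e * _]mulrC -mulrBr normrM (ger0_norm (k0 u)).
  by rewrite mulrCA ler_wpM2l// distrC fH.
have -> : p * \int[lebesgue_measure]_(u in D) (`|u - e| `^ (p - 1) * f u) =
    L `^ (p - 1) * \int[lebesgue_measure]_(u in D) (k u * f u).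
  have -> : \int[lebesgue_measure]_(u in D) (`|u - e| `^ (p - 1) * f u) =
      \int[lebesgue_measure]_(u in D) (L `^ (p - 1) / p * (k u * f u)).
    apply: eq_Rintegral => u; rewrite inE => /TD; rewrite in_itv/= => /andP[T0 T1].
    have -> : `|u - e| = L * T u.
      by rewrite -[T u]ger0_norm// -normrM /T mulrC divfK// subr_eq0 eq_sym.
    rewrite powRM ?(ltW L0)// /k; field.
    by rewrite gt_eqF.
  rewrite RintegralZl//; field.
  by rewrite gt_eqF.
have LE : L `^ p = L `^ (p - 1) * L by rewrite mulrC mulr_powRB1// ltW.
have -> : L `^ (p + 1) = L `^ (p - 1) * L * L.
  by rewrite powRD ?(gt_eqF L0) ?implybT// powRr1 ?(ltW L0)// LE.
rewrite LE -[X in `|X - _|]mulrA -mulrBr normrM (ger0_norm (powR_ge0 _ _)).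
by rewrite -!mulrA ler_wpM2l ?powR_ge0// [L * f e]mulrC.
Qed.

(** The concave power [1 / q] of the bound on [|g| `^ q] is replaced by its tangent
    at the mean [S / K], which makes the bound linear, hence explicitly integrable,
    and loses nothing with respect to the power-mean inequality. *)
Lemma side_estimate {R : realType} (f g : R -> R) (e x p s q A B : R) :
  let D := `[Num.min e x, Num.max e x]%classic in
  e != x -> 0 < p -> 0 < s -> 1 <= q -> 0 <= A -> 0 <= B ->
  {within D, continuous f} ->
  {in `]Num.min e x, Num.max e x[, forall u : R, is_derive u 1 f (g u)} ->
  {in `]Num.min e x, Num.max e x[, forall u : R, `|g u| `^ q <=
     A * ((u - e) / (x - e)) `^ s + B * (1 - (u - e) / (x - e)) `^ s} ->
  `| `|x - e| `^ p * f e -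
     p * \int[lebesgue_measure]_(u in D) (`|u - e| `^ (p - 1) * f u) | <=
  `|x - e| `^ (p + 1) * ((p / (p + 1)) `^ (1 - 1 / q) *
    (p / ((s + 1) * (p + s + 1)) * A +
     (1 / (s + 1) - betaI p s) * B) `^ (1 / q)).
Proof.
move=> D ex p0 s0 q1 A0 B0 cf df gle.
have q0 : 0 < q by lra.
have s1 : 0 < s + 1 by lra.
have p1 : 0 < p + 1 by lra.
have ps1 : 0 < p + s + 1 by lra.
have mf : measurable_fun D f.
  by apply: subspace_continuous_measurable_fun => //; exact: measurable_itv.
set kap := p / ((s + 1) * (p + s + 1)).
set bet := 1 / (s + 1) - betaI p s.
set K := p / (p + 1).
have kap0 : 0 < kap by rewrite divr_gt0 ?mulr_gt0.
have bet0 : 0 < bet by exact: beta_gap_gt0.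
have K0 : 0 < K by rewrite divr_gt0.
set S := kap * A + bet * B.
have S0 : 0 <= S by rewrite /S addr_ge0// mulr_ge0// ltW.
have iq0 : 0 < 1 / q by rewrite divr_gt0.
have iq1 : 1 / q <= 1 by rewrite ler_pdivrMr// mul1r.
have gE u : `|g u| = (`|g u| `^ q) `^ (1 / q).
  by rewrite -powRrM mul1r divff ?gt_eqF// powRr1.
suff [c0 [c1 [c00 c10 gc cE]]] : exists c0 c1 : R, [/\ 0 <= c0, 0 <= c1,
    {in `]Num.min e x, Num.max e x[, forall u : R, `|g u| <= c0 + c1 *
      (A * ((u - e) / (x - e)) `^ s + B * (1 - (u - e) / (x - e)) `^ s)} &
    c0 * K + c1 * S = K `^ (1 - 1 / q) * S `^ (1 / q)].
  rewrite -cE; have -> : c0 * K + c1 * S = c0 * K + c1 * (A * kap + B * bet).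
    by rewrite /S; ring.
  apply: one_sided_bound => //; first exact: majorant_ge0.
  exact: increment_le_majorant df gc.
(* The tangent at [S / K] exists only for [S > 0]; [S = 0] forces [A = B = 0],
   and then [g] vanishes. *)
move: S0; rewrite le_eqVlt => /predU1P[S0|S0]; last first.
  have [c0 [c1 [c00 c10 tan cE]]] := exists_linear_majorant iq0 iq1 K0 S0.
  exists c0, c1; split => // u uD; rewrite gE.
  set phi := A * _ + _.
  have phi0 : 0 <= phi by rewrite addr_ge0 ?mulr_ge0 ?powR_ge0.
  apply: (@le_trans _ _ (phi `^ (1 / q))); last exact: tan.
  by apply: ge0_ler_powR; rewrite ?nnegrE ?powR_ge0 ?(ltW iq0)//; exact: gle.
have kA : 0 <= kap * A by rewrite mulr_ge0// ltW.
have bB : 0 <= bet * B by rewrite mulr_ge0// ltW.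
have AE : A = 0.
  have : kap * A = 0 by move: S0; rewrite /S; lra.
  by move/eqP; rewrite mulf_eq0 gt_eqF//= => /eqP.
have BE : B = 0.
  have : bet * B = 0 by move: S0; rewrite /S; lra.
  by move/eqP; rewrite mulf_eq0 gt_eqF//= => /eqP.
exists 0, 0; split => //.
  move=> u uD; have := gle u uD; rewrite AE BE !mul0r !addr0 => h; rewrite gE.
  have -> : `|g u| `^ q = 0 by apply/eqP; rewrite eq_le h powR_ge0.
  by rewrite powR0 ?gt_eqF.
by rewrite -S0 powR0 ?gt_eqF// !mul0r mulr0 addr0.
Qed.

(** * Fractional integrals of a function with s-convex derivative *)

(** The increment is [h] times a convergent difference quotient. *)
Lemma derivable_in_continuous {R : realType} (D : set R) (f : R -> R) (y : R) :
  derivable_in D f y -> f z @[z --> within D (nbhs y)] --> f y.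
Proof.
move=> /cvg_ex[/= l fl].
set F := within [set h | D (h + y)] (0 : R)^' in fl.
have h0 : h @[h --> F] --> (0 : R).
  by move=> P [e e0 eP]; exists e => // h /eP Ph _ _.
have fF : (h * (h^-1 * (f (h + y) - f y)) @[h --> F]) --> (0 : R).
  by rewrite -[X in _ --> X](mul0r l); apply: cvgM.
apply/cvgrPdist_lt => e e0.
move/cvgrPdist_lt : fF => /(_ e e0) near0.
suff H : \forall z \near nbhs (y : R^o), D z -> `|f y - f z| < e by exact: H.
have [d /= d0 near0d] : \forall h \near (0 : R), h != 0 -> D (h + y) ->
    `|0 - h * (h^-1 * (f (h + y) - f y))| < e by exact: near0.
exists d => // z /= zd Dz; have [->|zy] := eqVneq z y.
  by rewrite subrr normr0.
have := near0d (z - y); rewrite /ball_/= sub0r normrN distrC => /(_ zd).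
rewrite subr_eq0 subrK => /(_ zy Dz).
by rewrite sub0r normrN mulrA divff ?subr_eq0// mul1r distrC.
Qed.

Lemma is_interval_interior {R : realType} (I : set R) (a b : R) :
  is_interval I -> I a -> I b -> `]a, b[%classic `<=` I°.
Proof.
move=> hI Ia Ib; rewrite -open_subsetE; last exact: interval_open.
by move=> y /=; rewrite in_itv/= => /andP[ay yb]; apply: (hI a b) => //; rewrite !ltW.
Qed.

Lemma GammaD1_RLminus {R : realType} (f : R -> R) (a x p : R) : 0 < p ->
  Gamma (p + 1) * RLminus x p f a =
  p * \int[lebesgue_measure]_(u in `[a, x]) (`|u - a| `^ (p - 1) * f u).
Proof.
move=> p0; have Gp := Gamma_gt0 p0.
rewrite /RLminus (GammaD1 p0) mulrA (mulfK (lt0r_neq0 Gp)); congr (_ * _).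
apply: eq_Rintegral => u; rewrite inE/= in_itv/= => /andP[au _].
by rewrite ger0_norm ?subr_ge0.
Qed.

Lemma GammaD1_RLplus {R : realType} (f : R -> R) (b x p : R) : 0 < p ->
  Gamma (p + 1) * RLplus x p f b =
  p * \int[lebesgue_measure]_(u in `[x, b]) (`|u - b| `^ (p - 1) * f u).
Proof.
move=> p0; have Gp := Gamma_gt0 p0.
rewrite /RLplus (GammaD1 p0) mulrA (mulfK (lt0r_neq0 Gp)); congr (_ * _).
apply: eq_Rintegral => u; rewrite inE/= in_itv/= => /andP[_ ub].
by rewrite distrC ger0_norm ?subr_ge0.
Qed.

Lemma itvcc_min_max {R : realType} (a b e x y : R) :
  e \in `[a, b] -> x \in `[a, b] ->
  y \in `[Num.min e x, Num.max e x] -> y \in `[a, b].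
Proof.
rewrite !in_itv/= => /andP[ae eb] /andP[ax xb] /andP[ey yx].
apply/andP; split; first by rewrite (le_trans _ ey)// le_min ae.
by rewrite (le_trans yx)// ge_max eb.
Qed.

Lemma itvoo_min_max {R : realType} (a b e x y : R) :
  e \in `[a, b] -> x \in `[a, b] ->
  y \in `]Num.min e x, Num.max e x[ -> y \in `]a, b[.
Proof.
rewrite !in_itv/= => /andP[ae eb] /andP[ax xb] /andP[ey yx].
apply/andP; split; first by rewrite (le_lt_trans _ ey)// le_min ae.
by rewrite (lt_le_trans yx)// ge_max eb.
Qed.

Lemma normr_sum_div_le {R : realFieldType} (d P Q G X Y ua ub K Sa Sb : R) :
  0 < d -> `|P - G * X| <= ua * (K * Sa) -> `|Q - G * Y| <= ub * (K * Sb) ->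
  `|(P + Q) / d - G / d * (X + Y)| <= K * (ua / d * Sa + ub / d * Sb).
Proof.
move=> d0 hX hY.
have -> : (P + Q) / d - G / d * (X + Y) = ((P - G * X) + (Q - G * Y)) / d by ring.
have -> : K * (ua / d * Sa + ub / d * Sb) = (ua * (K * Sa) + ub * (K * Sb)) / d.
  by ring.
rewrite normrM normfV (gtr0_norm d0) ler_pM2r ?invr_gt0//.
exact: le_trans (ler_normD _ _) (lerD hX hY).
Qed.

Unset Implicit Arguments.
Set Strict Implicit.

Theorem theorem9 (R : realType) (I : set R) (f : R -> R) (a b q alpha s x : R)
  (hI : is_interval I) (hI0 : I `<=` [set y | 0 <= y])
  (hf : forall y, I° y -> derivable f y 1)
  (ha : I a) (hb : I b) (hab : a < b)
  (hf' : forall y, y \in `[a, b] -> derivable_in I f y)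
  (hL : lebesgue_measure.-integrable
          `[a, b] (EFin \o derive_in I f))
  (hq : 1 <= q) (halpha : 0 < alpha) (hs0 : 0 < s) (hs1 : s <= 1)
  (hconv : s_convex_on s `[a, b] (fun t => `|derive_in I f t| `^ q))
  (hx : x \in `[a, b]) :
  `| ((x - a) `^ alpha * f a + (b - x) `^ alpha * f b) / (b - a)
     - Gamma (alpha + 1) / (b - a) *
       (RLminus x alpha f a + RLplus x alpha f b) |
  <= (alpha / (alpha + 1)) `^ (1 - 1 / q) *
     ( (x - a) `^ (alpha + 1) / (b - a) *
         ( alpha / ((s + 1) * (alpha + s + 1)) * `|derive_in I f x| `^ q
           + (1 / (s + 1)
              - Gamma (alpha + 1) * Gamma (s + 1) / Gamma (alpha + s + 2))
             * `|derive_in I f a| `^ q ) `^ (1 / q)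
     + (b - x) `^ (alpha + 1) / (b - a) *
         ( alpha / ((s + 1) * (alpha + s + 1)) * `|derive_in I f x| `^ q
           + (1 / (s + 1)
              - Gamma (alpha + 1) * Gamma (s + 1) / Gamma (alpha + s + 2))
             * `|derive_in I f b| `^ q ) `^ (1 / q) ).
Proof.
have [ax xb] : a <= x /\ x <= b by move: hx; rewrite in_itv/= => /andP[].
have Ga : 0 < Gamma alpha by exact: Gamma_gt0.
have Gas : 0 < Gamma (alpha + s + 2) by apply: Gamma_gt0; lra.
rewrite Gamma_beta// (mulfK (lt0r_neq0 Gas)).
have ba0 : 0 < b - a by rewrite subr_gt0.
pose g := derive_in I f.
have cf : {within `[a, b], continuous f}.
  apply/subspace_continuousP => y /= yab.
  apply: cvg_trans (derivable_in_continuous (hf' y yab)).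
  apply: cvg_app; apply: within_subset => z /=; rewrite in_itv/= => /andP[az zb].
  by apply: (hI a b) => //; rewrite az zb.
have dfg u : u \in `]a, b[ -> is_derive u 1 f (g u).
  move=> uab; have Iu : I° u by exact: (is_interval_interior hI ha hb).
  by rewrite /g derive_in_interior// derive1E; apply: derivableP; exact: hf.
have side e : e \in `[a, b] ->
  `| `|x - e| `^ alpha * f e - alpha *
     \int[lebesgue_measure]_(u in `[Num.min e x, Num.max e x])
        (`|u - e| `^ (alpha - 1) * f u) | <=
  `|x - e| `^ (alpha + 1) * ((alpha / (alpha + 1)) `^ (1 - 1 / q) *
    (alpha / ((s + 1) * (alpha + s + 1)) * `|g x| `^ q +
     (1 / (s + 1) - betaI alpha s) * `|g e| `^ q) `^ (1 / q)).
  move=> eab; have [->|ex] := eqVneq e x.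
    rewrite minxx maxxx set_itv1 Rintegral_set1 mulr0 subr0 subrr normr0.
    rewrite powR0 ?gt_eqF// mul0r normr0.
    by rewrite !mulr_ge0 ?powR_ge0.
  apply: (@side_estimate R f g) => //; rewrite ?powR_ge0//.
  - by apply: continuous_subspaceW cf => y; exact: itvcc_min_max eab hx.
  - by move=> u /(itvoo_min_max eab hx); exact: dfg.
  - move=> u uD; have := affine_oo ex uD.
    set t := (u - e) / (x - e); rewrite in_itv/= => /andP[t0 t1].
    have t1' : 0 <= 1 - t by rewrite subr_ge0 ltW.
    have tt : t + (1 - t) = 1 by ring.
    have := hconv x e hx eab t (1 - t) (ltW t0) t1' tt.
    have -> : t * x + (1 - t) * e = u.
      have -> : t * x + (1 - t) * e = t * (x - e) + e by ring.
      by rewrite /t divfK ?subrK// subr_eq0 eq_sym.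
    by rewrite ![_ `^ s * _]mulrC.
apply: normr_sum_div_le => //.
- have := side a; rewrite in_itv/= lexx (ltW hab) => /(_ isT).
  rewrite (min_l ax) (max_r ax) -(GammaD1_RLminus f a x halpha).
  by rewrite [`|x - a|]ger0_norm ?subr_ge0.
- have := side b; rewrite in_itv/= lexx (ltW hab) => /(_ isT).
  rewrite (min_r xb) (max_l xb) -(GammaD1_RLplus f b x halpha).
  by rewrite [`|x - b|]distrC [`|b - x|]ger0_norm ?subr_ge0.
Qed.
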